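(* Let $V$ be the set of quintuples of pairwise distinct points of $\mathbb{P}^1$ over $\mathbb{C}$, let $P=V/SL_2$, and let $\bar{J}:P/\mathfrak{S}_5\rightarrow \mathrm{Sym}^5(\mathbb{P}^1)$ be the map which sends the class of $(\lambda_1,\ldots,\lambda_5)$ to the unordered quintuple (multiset) of the $j$-invariants $j_1,\ldots,j_5$, where $j_l$ is the $j$-invariant of the four-point set $\{\lambda_1,\ldots,\widehat{\lambda_l},\ldots,\lambda_5\}$ obtained by omitting $\lambda_l$. Then the map $\bar{J}$ is injective.
   Context: The base field is $\mathbb{C}$. $V=(\mathbb{P}^1)^5\setminus\Delta$, where $\Delta$ is the big diagonal (the set of quintuples with at least two equal entries). The group $SL_2$ acts diagonally on $V$ by homographies, and the symmetric group $\mathfrak{S}_5$ acts by permuting the entries; the two actions commute. The $j$-invariant of a set of four distinct points of $\mathbb{P}^1$ is defined as follows. If $Q(x_1,x_2)=q_0x_1^4+4q_1x_1^3x_2+6q_2x_1^2x_2^2+4q_3x_1x_2^3+q_4x_2^4$ is a binary quartic whose roots are these four points, then $$j=\frac{S(Q)^3}{S(Q)^3-27\,T(Q)^2},$$ where $S(Q)=q_0q_4-4q_1q_3+3q_2^2$ and $T(Q)=q_0q_2q_4+2q_1q_2q_3-q_2^3-q_0q_3^2-q_1^2q_4$. For the points $0,1,\infty,\lambda$ this equals $\frac{4}{27}\cdot\frac{(\lambda^2-\lambda+1)^3}{\lambda^2(\lambda-1)^2}$. The map $J:V\to(\mathbb{P}^1)^5$, $(\lambda_1,\ldots,\lambda_5)\mapsto(j_1,\ldots,j_5)$,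 is $\mathfrak{S}_5$-equivariant and constant on $SL_2$-orbits, so it induces the map $\bar J:P/\mathfrak{S}_5\to \mathrm{Sym}^5(\mathbb{P}^1)=(\mathbb{P}^1)^5/\mathfrak{S}_5$. *)

(* Defs.v *)
From mathcomp Require Import all_boot all_order all_algebra all_fingroup.
From mathcomp Require Import generic_quotient.
From mathcomp Require Import boolp classical_sets reals.
From mathcomp Require Import complex.
From mathcomp Require Import ring.

Set Implicit Arguments.
Unset Strict Implicit.
Unset Printing Implicit Defensive.

Import Order.TTheory GRing.Theory Num.Theory.
Local Open Scope classical_set_scope.
Local Open Scope ring_scope.
Local Open Scope quotient_scope.

Section ProjectiveLine.
Variable F : numFieldType.

(* points of the projective line = lines of F^2 *)
Definition P1 : Type := {L : {vspace 'cV[F]_2} | \dim L == 1}.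

Definition vec2 (a b : F) : 'cV[F]_2 := \col_i (if i == 0 then a else b).

Lemma vec2_1_neq0 t : vec2 t 1 != 0.
Proof.
by apply/eqP => /colP /(_ 1); rewrite !mxE /= => /eqP; rewrite oner_eq0.
Qed.

Lemma dim_P1aff t : \dim <[vec2 t 1]>%VS == 1.
Proof. by rewrite dim_vline vec2_1_neq0. Qed.

(* the embedding t |-> [t : 1] of the affine line *)
Definition P1aff (t : F) : P1 := Sub <[vec2 t 1]>%VS (dim_P1aff t).

Definition homography (g : 'M[F]_2) (L : {vspace 'cV[F]_2}) :
  {vspace 'cV[F]_2} := (linfun (mulmx g) @: L)%VS.

Lemma homography1 L : homography 1%:M L = L.
Proof.
rewrite /homography (_ : linfun (mulmx 1%:M) = \1%VF) ?lim1g//.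
by apply/lfunP => v; rewrite !lfunE /= mul1mx.
Qed.

Lemma homographyM g h L :
  homography (g *m h) L = homography g (homography h L).
Proof.
rewrite /homography -limg_comp; congr (_ @: _)%VS.
by apply/lfunP => v; rewrite !lfunE /= !lfunE /= mulmxA.
Qed.

End ProjectiveLine.

Section JInvariant.
Variable F : numFieldType.

(* q i is the coefficient q_i, binomial factor removed. *)
Definition quartic := {ffun 'I_5 -> F}.

(* sum of C(4,i) q_i x_1^(4-i) x_2^i, with (x_1, x_2) = (v 0 0, v 1 0) *)
Definition qeval (q : quartic) (v : 'cV[F]_2) : F :=
  \sum_(i < 5) 'C(4, i)%:R * q i * v 0 0 ^+ (4 - i) * v 1 0 ^+ i.

Definition qS (q : quartic) : F := q 0 * q 4 - 4 * q 1 * q 3 + 3 * q 2 ^+ 2.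

Definition qT (q : quartic) : F :=
  q 0 * q 2 * q 4 + 2 * q 1 * q 2 * q 3 - q 2 ^+ 3
  - q 0 * q 3 ^+ 2 - q 1 ^+ 2 * q 4.

Definition qj (q : quartic) : F :=
  qS q ^+ 3 / (qS q ^+ 3 - 27 * qT q ^+ 2).

Definition qroot (q : quartic) (p : P1 F) : Prop :=
  forall v, v \in val p -> qeval q v = 0.

(* j(Q) for any quartic Q whose set of roots is A; meaningful when A consists
   of four distinct points, in which case the denominator of qj is nonzero. *)
Definition jinv (A : set (P1 F)) : F := qj (xget 0 [set q | [set p | qroot q p] = A]).

End JInvariant.

(* T^5 and its quotient by the permutations of the entries *)
Section Sym5.
Variable T : choiceType.
Local Notation T5 := {ffun 'I_5 -> T}.

Definition perm5 (s : 'S_5) (x : T5) : T5 := [ffun i => x (s i)].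

Lemma perm5_1 x : perm5 1 x = x.
Proof. by apply/ffunP => i; rewrite ffunE perm1. Qed.

Lemma perm5M s t x : perm5 (s * t)%g x = perm5 s (perm5 t x).
Proof. by apply/ffunP => i; rewrite !ffunE permM. Qed.

Definition sym_rel (x y : T5) : bool := [exists s, y == perm5 s x].

Lemma sym_rel_refl : reflexive sym_rel.
Proof. by move=> x; apply/existsP; exists 1%g; rewrite perm5_1. Qed.

Lemma sym_rel_sym : symmetric sym_rel.
Proof.
suff H x y : sym_rel x y -> sym_rel y x by move=> x y; apply/idP/idP; exact: H.
case/existsP => s /eqP ->; apply/existsP; exists s^-1%g.
by rewrite -perm5M mulVg perm5_1.
Qed.

Lemma sym_rel_trans : transitive sym_rel.
Proof.
move=> y x z /existsP[s /eqP ->] /existsP[t /eqP ->].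
by apply/existsP; exists (t * s)%g; rewrite perm5M.
Qed.

Canonical sym_equiv := EquivRel sym_rel sym_rel_refl sym_rel_sym sym_rel_trans.

Definition Sym5 := {eq_quot sym_equiv}.

End Sym5.

Section ModuliSpace.
Variable F : numFieldType.

Definition V : Type := {x : {ffun 'I_5 -> P1 F} | injectiveb x}.

Definition sl2_rel (x y : V) : bool :=
  `[< exists2 g : 'M[F]_2, \det g = 1 &
      forall i, val (val y i) = homography g (val (val x i)) >].

Lemma sl2_rel_refl : reflexive sl2_rel.
Proof.
by move=> x; apply/asboolP; exists 1%:M => [|i]; rewrite ?det1 ?homography1.
Qed.

Lemma sl2_rel_sym : symmetric sl2_rel.
Proof.
suff H x y : sl2_rel x y -> sl2_rel y x by move=> x y; apply/idP/idP; exact: H.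
move=> /asboolP[g g1 xy]; apply/asboolP; exists (invmx g) => [|i].
  by rewrite det_inv g1 invr1.
by rewrite xy -homographyM mulVmx ?homography1// unitmxE g1 unitr1.
Qed.

Lemma sl2_rel_trans : transitive sl2_rel.
Proof.
move=> y x z /asboolP[g g1 xy] /asboolP[h h1 yz]; apply/asboolP.
by exists (h *m g) => [|i]; rewrite ?det_mulmx ?g1 ?h1 ?mulr1// yz xy homographyM.
Qed.

Canonical sl2_equiv := EquivRel sl2_rel sl2_rel_refl sl2_rel_sym sl2_rel_trans.

Definition P := {eq_quot sl2_equiv}.

Lemma permV_subproof (s : 'S_5) (x : V) : injectiveb (perm5 s (val x)).
Proof.
apply/injectiveP => i j; rewrite !ffunE => /(injectiveP _ (valP x)).
exact: perm_inj.
Qed.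

Definition permV (s : 'S_5) (x : V) : V :=
  Sub (perm5 s (val x)) (permV_subproof s x).

Definition permP (s : 'S_5) (p : P) : P := \pi_P (permV s (repr p)).

Lemma permP_pi s (x : V) : permP s (\pi_P x) = \pi_P (permV s x).
Proof.
have /eqmodP /asboolP[g g1 xy] : repr (\pi_P x) = x %[mod P] by rewrite reprK.
by apply/eqmodP/asboolP; exists g => // i; rewrite !ffunE xy.
Qed.

Lemma permP_1 p : permP 1 p = p.
Proof.
rewrite -[p]reprK permP_pi; congr (\pi_P _).
by apply/val_inj; rewrite /= perm5_1.
Qed.

Lemma permP_M s t p : permP (s * t)%g p = permP s (permP t p).
Proof.
rewrite -[p]reprK; move: (repr p) => x.
rewrite (permP_pi (s * t)%g) (permP_pi t) permP_pi; congr (\pi_P _).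
by apply/val_inj; rewrite /= perm5M.
Qed.

Definition permP_rel (p q : P) : bool := [exists s, q == permP s p].

Lemma permP_rel_refl : reflexive permP_rel.
Proof. by move=> p; apply/existsP; exists 1%g; rewrite permP_1. Qed.

Lemma permP_rel_sym : symmetric permP_rel.
Proof.
suff H p q : permP_rel p q -> permP_rel q p.
  by move=> p q; apply/idP/idP; exact: H.
case/existsP => s /eqP ->; apply/existsP; exists s^-1%g.
by rewrite -permP_M mulVg permP_1.
Qed.

Lemma permP_rel_trans : transitive permP_rel.
Proof.
move=> q p r /existsP[s /eqP ->] /existsP[t /eqP ->].
by apply/existsP; exists (t * s)%g; rewrite permP_M.
Qed.

Canonical permP_equiv :=
  EquivRel permP_rel permP_rel_refl permP_rel_sym permP_rel_trans.

Definition PmodS5 := {eq_quot permP_equiv}.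

(* The j-invariants are finite, and are seen in P^1 through P1aff. *)
Definition J (x : V) : {ffun 'I_5 -> P1 F} :=
  [ffun l => P1aff (jinv [set val x i | i in [set i | i != l]])].

(* J on a representative; see JbarE for independence of the choice. *)
Definition Jbar (c : PmodS5) : Sym5 (P1 F) :=
  \pi_(Sym5 (P1 F)) (J (repr (repr c))).

End ModuliSpace.

(* Well-definedness: jinv does not depend on the quartic (quartic_ex, jinvE),
   has the expected value on {0, 1, oo, t} (jinv_01infE), and Jbar is the map
   induced by J (JbarE). *)
Section WellDefined.
Variable F : numFieldType.

Definition quartic_of (a b c d e : F) : quartic F :=
  [ffun i : 'I_5 => [:: a; b; c; d; e]`_i].

Lemma quartic_ofE (a b c d e : F) :
  ((quartic_of a b c d e 0 = a) * (quartic_of a b c d e 1 = b) *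
  (quartic_of a b c d e 2 = c) * (quartic_of a b c d e 3 = d) *
  (quartic_of a b c d e 4 = e))%type.
Proof. by rewrite /quartic_of !ffunE. Qed.

Lemma qevalE (q : quartic F) v : qeval q v =
  q 0 * v 0 0 ^+ 4 + 4 * q 1 * v 0 0 ^+ 3 * v 1 0
  + 6 * q 2 * v 0 0 ^+ 2 * v 1 0 ^+ 2 + 4 * q 3 * v 0 0 * v 1 0 ^+ 3
  + q 4 * v 1 0 ^+ 4.
Proof.
have o (i j : 'I_5) : val i = val j -> q i = q j by move=> /val_inj ->.
rewrite /qeval !big_ord_recl big_ord0 /=.
rewrite -(o 0 ord0)// -(o 1 (lift ord0 ord0))//.
rewrite -(o 2 (lift ord0 (lift ord0 ord0)))//.
rewrite -(o 3 (lift ord0 (lift ord0 (lift ord0 ord0))))//.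
rewrite -(o 4 (lift ord0 (lift ord0 (lift ord0 (lift ord0 ord0)))))//.
rewrite /bump /= !add1n !subSS subn0.
rewrite (_ : 'C(4, 0) = 1)%N// (_ : 'C(4, 1) = 4)%N// (_ : 'C(4, 2) = 6)%N//.
rewrite (_ : 'C(4, 3) = 4)%N// (_ : 'C(4, 4) = 1)%N//; ring.
Qed.

Lemma qevalZ (q : quartic F) k v : qeval q (k *: v) = k ^+ 4 * qeval q v.
Proof. by rewrite !qevalE !mxE; ring. Qed.

Lemma qroot_line (q : quartic F) (p : P1 F) v :
  val p = <[v]>%VS -> qroot q p <-> qeval q v = 0.
Proof.
move=> pv; split=> [|qv w]; first by apply; rewrite pv memv_line.
by rewrite pv => /vlineP[k ->]; rewrite qevalZ qv mulr0.
Qed.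

End WellDefined.

Section WellDefined.
Variable F : numFieldType.

Lemma vec2_neq0 (a b : F) : (a != 0) || (b != 0) -> vec2 a b != 0.
Proof.
apply: contraTneq => /colP ab0; move: (ab0 0) (ab0 1).
by rewrite !mxE /= => -> ->; rewrite eqxx.
Qed.

Lemma dim_P1inf : \dim <[vec2 1 0 : 'cV[F]_2]>%VS == 1.
Proof. by rewrite dim_vline vec2_neq0 ?oner_neq0. Qed.

Definition P1inf : P1 F := Sub <[vec2 1 0]>%VS dim_P1inf.

Definition P1opt (o : option F) : P1 F := oapp (@P1aff F) P1inf o.

Definition vopt (o : option F) : 'cV[F]_2 :=
  if o is Some t then vec2 t 1 else vec2 1 0.

Lemma P1opt_line o : val (P1opt o) = <[vopt o]>%VS.
Proof. by case: o. Qed.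

Lemma P1_vlineP (p : P1 F) : exists2 v, v != 0 & val p = <[v]>%VS.
Proof.
have /eqP p1 := valP p; exists (vpick (val p)).
  by rewrite vpick0 -dimv_eq0 p1.
apply/esym/eqP; rewrite eqEdim -memvE memv_pick/= dim_vline vpick0 -dimv_eq0 p1.
by [].
Qed.

Lemma vec2E (v : 'cV[F]_2) : v = vec2 (v 0 0) (v 1 0).
Proof.
apply/colP => i; rewrite mxE; case: ifPn => [/eqP->//|].
by case: i => [[|[|//]]] // i2 _; congr (v _ _); apply/val_inj.
Qed.

Lemma P1optP p : exists o, p = P1opt o.
Proof.
have [v v0 pv] := P1_vlineP p; have [b0|b0] := eqVneq (v 1 0) 0.
  have a0 : v 0 0 != 0.
    apply: contraNneq v0 => a0; rewrite (vec2E v) a0 b0.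
    by apply/eqP/colP => i; rewrite !mxE if_same.
  exists None; apply/val_inj; rewrite /= pv; apply/eqP.
  rewrite eqEdim !dim_vline v0 vec2_neq0 ?oner_neq0// andbT -memvE.
  apply/vlineP; exists (v 0 0); rewrite [LHS]vec2E b0.
  by apply/colP => i; rewrite !mxE; case: ifP; rewrite ?mulr1 ?mulr0.
exists (Some (v 0 0 / v 1 0)); apply/val_inj; rewrite /= pv; apply/eqP.
rewrite eqEdim !dim_vline v0 vec2_1_neq0 andbT -memvE.
apply/vlineP; exists (v 1 0); rewrite [LHS]vec2E.
by apply/colP => i; rewrite !mxE; case: ifP; rewrite ?mulr1// mulrC divfK.
Qed.

Lemma qroot_opt (q : quartic F) o :
  qroot q (P1opt o) <-> qeval q (vopt o) = 0.
Proof. exact/qroot_line/P1opt_line. Qed.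

Lemma qroot_aff (q : quartic F) t : qroot q (P1aff t) <->
  q 0 * t ^+ 4 + 4 * q 1 * t ^+ 3 + 6 * q 2 * t ^+ 2 + 4 * q 3 * t + q 4 = 0.
Proof.
rewrite (qroot_opt q (Some t)) qevalE !mxE /=.
by rewrite !expr1n !mulr1.
Qed.

Lemma qroot_inf (q : quartic F) : qroot q P1inf <-> q 0 = 0.
Proof.
rewrite (qroot_opt q None) qevalE !mxE /=.
by rewrite !expr1n !expr0n /= !mulr0 !addr0 !mulr1.
Qed.

Lemma P1opt_inj : injective P1opt.
Proof.
move=> o o' oo.
pose q t : quartic F := quartic_of 0 0 0 (1 / 4) (- t).
have qinf t : qroot (q t) P1inf by apply/qroot_inf; rewrite quartic_ofE.
have n4 : 4 != 0 :> F by rewrite pnatr_eq0.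
have qaff t u : qroot (q t) (P1aff u) <-> u = t.
  rewrite qroot_aff !quartic_ofE !mulr0 !mul0r !add0r mul1r mulfV// mul1r.
  by split=> [/subr0_eq|->]//; rewrite subrr.
have ninf u : P1aff u <> P1inf.
  move=> E; have := qinf (u + 1); rewrite -E => /qaff /esym/eqP.
  by rewrite -subr_eq0 addrAC subrr add0r oner_eq0.
case: o o' oo => [u|] [t|] //= E.
- by congr Some; apply/(qaff t); rewrite E; exact/qaff.
- by case: (ninf u).
- by case: (ninf t).
Qed.

Lemma q_eq0 (q : quartic F) : q 0 = 0 -> q 1 = 0 -> q 2 = 0 -> q 3 = 0 ->
  q 4 = 0 -> q = 0.
Proof.
move=> q0 q1 q2 q3 q4; apply/ffunP => i; rewrite [RHS]ffunE.
have o (j : 'I_5) : val i = val j -> q i = q j by move=> /val_inj ->.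
case: i o => [[|[|[|[|[|//]]]]]] i5 o.
- by rewrite (o 0).
- by rewrite (o 1).
- by rewrite (o 2).
- by rewrite (o 3).
- by rewrite (o 4).
Qed.

Lemma qroot_5 (q : quartic F) (s : seq (P1 F)) : uniq s -> (4 < size s)%N ->
  (forall p, p \in s -> qroot q p) -> q = 0.
Proof.
move=> us s5 qs.
have [r sr] : exists r, s = map P1opt r.
  elim: s {us s5 qs} => [|p s [r ->]]; first by exists [::].
  by have [o ->] := P1optP p; exists (o :: r).
have ur : uniq r by rewrite -(map_inj_uniq P1opt_inj) -sr.
pose P := Poly [:: q 4; 4 * q 3; 6 * q 2; 4 * q 1; q 0].
have PE t : P.[t] = 0 <-> qroot q (P1aff t).
  rewrite qroot_aff; set e := (X in _ <-> X = 0).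
  suff -> : P.[t] = e by [].
  by rewrite /P /e horner_Poly /=; ring.
have P0 : P = 0 -> q = 0.
  move=> /polyP P0; have n4 : 4 != 0 :> F by rewrite pnatr_eq0.
  have n6 : 6 != 0 :> F by rewrite pnatr_eq0.
  move: (P0 0%N) (P0 1%N) (P0 2%N) (P0 3%N) (P0 4%N).
  rewrite !coef_Poly /= !coef0 => q4 /eqP q3 /eqP q2 /eqP q1 q0.
  by apply: q_eq0 => //; apply/eqP;
    [move: q1|move: q2|move: q3]; rewrite mulf_eq0 ?(negPf n4) ?(negPf n6).
apply: P0; apply/eqP; apply/negP => /negP Pn0.
have uro : uniq (pmap id r) by apply: (@pmap_uniq _ _ id Some) => // -[].
have allr : all (root P) (pmap id r).
  apply/allP => t; rewrite mem_pmap map_id => tr.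
  apply/rootP/PE/(qs (P1opt (Some t))).
  by rewrite sr map_f.
have := max_poly_roots Pn0 allr uro.
have szr : (size (pmap id r) + (None \in r) = size r)%N.
  rewrite size_pmap -(count_predC isSome r) -count_uniq_mem//.
  by congr (_ + _)%N; apply: eq_count => -[].
have sr4 : (4 < size r)%N by move: s5; rewrite sr size_map.
have [Nr|Nr] := boolP (None \in r); last first.
  move: szr; rewrite (negPf Nr) addn0 => ->.
  by rewrite ltnNge (leq_trans (size_Poly _ : size P <= 5)%N sr4).
move: szr; rewrite Nr addn1 => szr.
have q0 : q 0 = 0 by apply/qroot_inf/qs; rewrite sr (map_f P1opt Nr).
have -> : P = Poly [:: q 4; 4 * q 3; 6 * q 2; 4 * q 1].
  apply/polyP => i; rewrite !coef_Poly.
  by case: i => [|[|[|[|[|i]]]]] //=; rewrite ?q0 ?nth_nil.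
by rewrite ltnNge (leq_trans (size_Poly _)) //= -ltnS szr.
Qed.

End WellDefined.

Section WellDefined.
Variable F : numFieldType.

Lemma mem4P (s : seq (P1 F)) : size s = 4%N -> exists r,
  s = [seq P1opt o | o <- r] /\ size r = 4%N.
Proof.
move=> s4; suff [r sr] : exists r, s = [seq P1opt o | o <- r].
  by exists r; split=> //; rewrite -s4 sr size_map.
elim: s {s4} => [|p s [r ->]]; first by exists [::].
by have [o ->] := P1optP p; exists (o :: r).
Qed.

Lemma P1_notin (s : seq (P1 F)) : size s = 4%N -> exists p, p \notin s.
Proof.
move=> s4; pose r := [seq P1opt (Some (i%:R : F)) | i <- iota 0 5].
have ur : uniq r.
  rewrite map_inj_uniq ?iota_uniq// => i j /P1opt_inj [] /eqP.
  by rewrite eqr_nat => /eqP.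
have [/allP rs|/allPn[p _ ps]] := boolP (all (mem s) r); last by exists p.
by have := uniq_leq_size ur rs; rewrite size_map size_iota s4.
Qed.

Definition qscale (c : F) (q : quartic F) : quartic F := [ffun i => c * q i].

Lemma qeval_comb c d (q r : quartic F) v :
  qeval [ffun i => c * q i - d * r i] v = c * qeval q v - d * qeval r v.
Proof. by rewrite !qevalE !ffunE; ring. Qed.

Lemma quartic_unique (s : seq (P1 F)) q r : uniq s -> size s = 4%N ->
  [set p | qroot q p] = [set` s] -> [set p | qroot r p] = [set` s] ->
  exists2 c, c != 0 & r = qscale c q.
Proof.
move=> us s4 /seteqP[qs sq] /seteqP[rs sr].
have [p ps] := P1_notin s4; have [v _ pv] := P1_vlineP p.
have nq : qeval q v != 0.
  by apply: contra ps => /eqP qv; apply/qs/(qroot_line q pv).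
have nr : qeval r v != 0.
  by apply: contra ps => /eqP rv; apply/rs/(qroot_line r pv).
have e0 : [ffun i => qeval q v * r i - qeval r v * q i] = 0 :> quartic F.
  apply: (@qroot_5 _ _ (p :: s)); rewrite /= ?s4 ?ps// => p'.
  rewrite inE => /predU1P[->|p's].
    by apply/(qroot_line _ pv); rewrite qeval_comb mulrC subrr.
  move=> w wp'; rewrite qeval_comb (sq _ p's w wp') (sr _ p's w wp').
  by rewrite !mulr0 subrr.
exists (qeval r v / qeval q v); first by rewrite mulf_neq0 ?invr_eq0.
apply/ffunP => i; move/ffunP/(_ i) : e0; rewrite !ffunE => /subr0_eq e.
by apply: (mulfI nq); rewrite e mulrA mulrCA mulfV// mulr1.
Qed.

Lemma qj_scale c (q : quartic F) : c != 0 -> qj (qscale c q) = qj q.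
Proof.
move=> c0; rewrite /qj.
have -> : qS (qscale c q) = c ^+ 2 * qS q by rewrite /qS !ffunE; ring.
have -> : qT (qscale c q) = c ^+ 3 * qT q by rewrite /qT !ffunE; ring.
have -> : (c ^+ 2 * qS q) ^+ 3 = c ^+ 6 * qS q ^+ 3 by ring.
have -> : c ^+ 6 * qS q ^+ 3 - 27 * (c ^+ 3 * qT q) ^+ 2 =
  c ^+ 6 * (qS q ^+ 3 - 27 * qT q ^+ 2) by ring.
by rewrite -mulf_div divff ?mul1r// expf_neq0.
Qed.

Lemma jinvE (s : seq (P1 F)) q : uniq s -> size s = 4%N ->
  [set p | qroot q p] = [set` s] -> jinv [set` s] = qj q.
Proof.
move=> us s4 qs; rewrite /jinv; set r := xget _ _.
have rs : [set p | qroot r p] = [set` s].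
  by have := @xgetI _ 0 [set q | [set p | qroot q p] = [set` s]] q qs.
by have [c c0 ->] := quartic_unique us s4 qs rs; rewrite qj_scale.
Qed.

Lemma quartic_prod (v1 v2 v3 v4 : 'cV[F]_2) : exists q : quartic F,
  forall v, qeval q v =
    (v1 1 0 * v 0 0 - v1 0 0 * v 1 0) * (v2 1 0 * v 0 0 - v2 0 0 * v 1 0) *
    (v3 1 0 * v 0 0 - v3 0 0 * v 1 0) * (v4 1 0 * v 0 0 - v4 0 0 * v 1 0).
Proof.
pose a1 := v1 0 0; pose b1 := v1 1 0; pose a2 := v2 0 0; pose b2 := v2 1 0.
pose a3 := v3 0 0; pose b3 := v3 1 0; pose a4 := v4 0 0; pose b4 := v4 1 0.
exists (quartic_of (b1 * b2 * b3 * b4)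
  (- (a1 * b2 * b3 * b4 + b1 * a2 * b3 * b4 + b1 * b2 * a3 * b4
      + b1 * b2 * b3 * a4) / 4)
  ((a1 * a2 * b3 * b4 + a1 * b2 * a3 * b4 + a1 * b2 * b3 * a4
    + b1 * a2 * a3 * b4 + b1 * a2 * b3 * a4 + b1 * b2 * a3 * a4) / 6)
  (- (b1 * a2 * a3 * a4 + a1 * b2 * a3 * a4 + a1 * a2 * b3 * a4
      + a1 * a2 * a3 * b4) / 4)
  (a1 * a2 * a3 * a4)) => v.
rewrite qevalE !quartic_ofE -/a1 -/a2 -/a3 -/a4 -/b1 -/b2 -/b3 -/b4.
by field.
Qed.

Lemma vopt_det (o u : option F) :
  (vopt o 1 0 * vopt u 0 0 - vopt o 0 0 * vopt u 1 0 == 0) = (o == u).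
Proof.
case: o u => [a|] [b|]; rewrite /vopt !mxE /= ?(mulr1, mul1r, mulr0, mul0r).
- by rewrite subr_eq0 eq_sym.
- by rewrite subr0 oner_eq0.
- by rewrite sub0r oppr_eq0 oner_eq0.
- by rewrite subr0 !eqxx.
Qed.

Lemma quartic_ex (s : seq (P1 F)) : size s = 4%N ->
  exists q, [set p | qroot q p] = [set` s].
Proof.
move=> /mem4P[r [-> ]]; case: r => [|o1 [|o2 [|o3 [|o4 [|//]]]]] // _.
have [q qE] := quartic_prod (vopt o1) (vopt o2) (vopt o3) (vopt o4).
exists q; apply/predeqP => p; have [o ->] := P1optP p.
rewrite /= qroot_opt qE; split=> [/eqP|].
  rewrite !mulf_eq0 !vopt_det -!orbA !inE !(inj_eq (@P1opt_inj F)).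
  by rewrite ![_ == o]eq_sym.
rewrite !inE !(inj_eq (@P1opt_inj F)) ![o == _]eq_sym => oo.
by apply/eqP; rewrite !mulf_eq0 !vopt_det -!orbA.
Qed.

Definition qcomp (q : quartic F) (h : 'M[F]_2) : quartic F :=
  let a := h 0 0 in let b := h 0 1 in let c := h 1 0 in let d := h 1 1 in
  quartic_of
  (a ^+ 4 * q 0
   + 4 * a ^+ 3 * c * q 1
   + 6 * a ^+ 2 * c ^+ 2 * q 2
   + 4 * a * c ^+ 3 * q 3
   + c ^+ 4 * q 4)
  (a ^+ 3 * b * q 0
   + 3 * a ^+ 2 * c * b * q 1
   + 3 * a * c ^+ 2 * b * q 2
   + c ^+ 3 * b * q 3
   + a ^+ 3 * d * q 1
   + 3 * a ^+ 2 * c * d * q 2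
   + 3 * a * c ^+ 2 * d * q 3
   + c ^+ 3 * d * q 4)
  (a ^+ 2 * b ^+ 2 * q 0
   + 2 * a * c * b ^+ 2 * q 1
   + c ^+ 2 * b ^+ 2 * q 2
   + 2 * a ^+ 2 * b * d * q 1
   + 4 * a * c * b * d * q 2
   + 2 * c ^+ 2 * b * d * q 3
   + a ^+ 2 * d ^+ 2 * q 2
   + 2 * a * c * d ^+ 2 * q 3
   + c ^+ 2 * d ^+ 2 * q 4)
  (a * b ^+ 3 * q 0
   + c * b ^+ 3 * q 1
   + 3 * a * b ^+ 2 * d * q 1
   + 3 * c * b ^+ 2 * d * q 2
   + 3 * a * b * d ^+ 2 * q 2
   + 3 * c * b * d ^+ 2 * q 3
   + a * d ^+ 3 * q 3
   + c * d ^+ 3 * q 4)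
  (b ^+ 4 * q 0
   + 4 * b ^+ 3 * d * q 1
   + 6 * b ^+ 2 * d ^+ 2 * q 2
   + 4 * b * d ^+ 3 * q 3
   + d ^+ 4 * q 4).

Lemma mulmx2E (h : 'M[F]_2) (v : 'cV[F]_2) i :
  (h *m v) i 0 = h i 0 * v 0 0 + h i 1 * v 1 0.
Proof.
rewrite mxE big_ord_recl big_ord1; congr (h _ _ * v _ _ + h _ _ * v _ _);
  exact/val_inj.
Qed.

Lemma det2E (h : 'M[F]_2) : \det h = h 0 0 * h 1 1 - h 0 1 * h 1 0.
Proof.
rewrite (expand_det_row _ 0) big_ord_recl big_ord1 /cofactor !det_mx11 !mxE /=.
rewrite addn0 add0n expr0 expr1 mul1r mulN1r mulrN.
by congr (h _ _ * h _ _ - h _ _ * h _ _); exact/val_inj.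
Qed.

Lemma qeval_comp q h v : qeval (qcomp q h) v = qeval q (h *m v).
Proof. by rewrite !qevalE !quartic_ofE !mulmx2E; ring. Qed.

Lemma qS_comp q h : qS (qcomp q h) = \det h ^+ 4 * qS q.
Proof. by rewrite /qS !quartic_ofE det2E; ring. Qed.

Lemma qT_comp q h : qT (qcomp q h) = \det h ^+ 6 * qT q.
Proof. by rewrite /qT !quartic_ofE det2E; ring. Qed.

Lemma jinv_homography (g : 'M[F]_2) (r s : seq (P1 F)) : \det g = 1 ->
  uniq r -> size r = 4%N -> uniq s ->
  [seq val p | p <- s] = [seq homography g (val p) | p <- r] ->
  jinv [set` s] = jinv [set` r].
Proof.
move=> g1 ur r4 us sr.
have s4 : size s = 4%N by rewrite -(size_map val) sr size_map.
have [q qr] := quartic_ex r4.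
have gu : g \in unitmx by rewrite unitmxE g1 unitr1.
have hI : \det (invmx g) = 1 by rewrite det_inv g1 invr1.
rewrite (jinvE ur r4 qr) (jinvE us s4 (q := qcomp q (invmx g))).
  by rewrite /qj qS_comp qT_comp hI !expr1n !mul1r.
apply/predeqP => p; have [v v0 pv] := P1_vlineP p.
have w0 : invmx g *m v != 0.
  by apply: contraNneq v0 => w0; rewrite -[v](mulKVmx gu) w0 mulmx0.
have dw : \dim <[invmx g *m v]>%VS == 1 by rewrite dim_vline w0.
pose p' : P1 F := Sub <[invmx g *m v]>%VS dw.
have pp' : val p = homography g (val p').
  by rewrite pv /homography limg_line lfunE /= mulKVmx.
have -> : [set p | qroot (qcomp q (invmx g)) p] p = [set p | qroot q p] p'.
  rewrite /= propeqE (qroot_line _ pv) (@qroot_line _ _ p' (invmx g *m v))//.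
  by rewrite qeval_comp.
rewrite qr /= -(mem_map val_inj s p) sr pp'.
rewrite (mem_map (f := homography g \o val))//= => x y /=.
move=> /(congr1 (homography (invmx g))).
by rewrite -!homographyM mulVmx// !homography1 => /val_inj.
Qed.

End WellDefined.

Section WellDefined.
Variable F : numFieldType.

Lemma set4_seq (T : choiceType) (a b c d : T) :
  [set a; b; c; d] = [set` [:: a; b; c; d]].
Proof.
apply/predeqP => p; rewrite /= !in_cons in_nil orbF; split.
  by case=> [[[->|->]|->]|->]; rewrite eqxx ?orbT.
by case/or4P => /eqP ->; tauto.
Qed.

Lemma jinv_01infE t : t != 0 -> t != 1 ->
  jinv [set P1aff 0; P1aff 1; P1inf F; P1aff t] =
  4 / 27 * ((t ^+ 2 - t + 1) ^+ 3 / (t ^+ 2 * (t - 1) ^+ 2)).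
Proof.
move=> t0 t1; pose s : seq (option F) := [:: Some 0; Some 1; None; Some t].
pose q := quartic_of 0 3 (- 2 * (1 + t)) (3 * t) 0.
have -> : [set P1aff 0; P1aff 1; P1inf F; P1aff t] = [set` map (@P1opt F) s]. exact: set4_seq.
have us : uniq [seq P1opt i | i <- s].
  rewrite (map_inj_uniq (@P1opt_inj F)) /= !inE !negb_or /= !(eq_sym _ (Some t)).
  by rewrite !eqE /= t0 t1 eq_sym oner_eq0.
rewrite (jinvE us (q := q))//.
  pose a := t ^+ 2 - t + 1; pose d := t ^+ 2 * (t - 1) ^+ 2.
  have SE : qS q = 12 * a by rewrite /qS !quartic_ofE /a; ring.
  have TE : qT q = 4 * (1 + t) * (2 * t ^+ 2 - 5 * t + 2).
    by rewrite /qT !quartic_ofE; ring.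
  have k0 : 12 ^+ 2 * 3 != 0 :> F by rewrite mulf_neq0 ?expf_neq0 ?pnatr_eq0.
  have d0 : d != 0 by rewrite mulf_neq0 ?expf_neq0 ?subr_eq0.
  rewrite /qj SE TE -/a -/d.
  rewrite (_ : (12 * a) ^+ 3 = 12 ^+ 2 * 3 * (4 * a ^+ 3)); last by ring.
  rewrite (_ : _ - _ = 12 ^+ 2 * 3 * (27 * d)); last by rewrite /a /d; ring.
  by rewrite -mulf_div divff// mul1r -mulf_div.
apply/predeqP => p; have [o ->] := P1optP p.
change (qroot q (P1opt o) <-> P1opt o \in map (@P1opt F) s).
rewrite (mem_map (@P1opt_inj F)) !in_cons in_nil orbF; case: o => [u|] /=.
  rewrite qroot_aff !quartic_ofE.
  set e := (X in X = 0).
  have -> : e = 12 * (u * (u - 1) * (u - t)) by rewrite /e; ring.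
  split=> [/eqP|].
    by rewrite !mulf_eq0 pnatr_eq0 !subr_eq0 -orbA.
  by rewrite !eqE /= => H; apply/eqP; rewrite !mulf_eq0 pnatr_eq0 !subr_eq0 -orbA.
by split=> // _; apply/qroot_inf; rewrite quartic_ofE.
Qed.

Definition others (x : V F) (l : 'I_5) : seq (P1 F) :=
  [seq val x i | i <- enum 'I_5 & i != l].

Lemma othersE (x : V F) (l : 'I_5) :
  [set val x i | i in [set i | i != l]] = [set` others x l].
Proof.
apply/predeqP => p; rewrite /= /others; split=> [[i /= il <-]|].
  by apply: map_f; rewrite mem_filter il mem_enum.
case/mapP => i; rewrite mem_filter => /andP[il _] ->.
by exists i.
Qed.

Lemma others_uniq (x : V F) (l : 'I_5) : uniq (others x l).
Proof.
rewrite map_inj_uniq; first by apply: filter_uniq; exact: enum_uniq.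
exact: (injectiveP _ (valP x)).
Qed.

Lemma size_others (x : V F) (l : 'I_5) : size (others x l) = 4%N.
Proof.
rewrite size_map -[LHS]/(size (filter (predC1 l) _)) size_filter.
have := count_predC (pred1 l) (enum 'I_5).
by rewrite (count_uniq_mem _ (enum_uniq _)) mem_enum size_enum_ord => -[].
Qed.

Lemma J_sl2 (x y : V F) : sl2_rel x y -> J x = J y.
Proof.
move=> /asboolP[g g1 xy]; apply/ffunP => l; rewrite !ffunE !othersE.
congr P1aff; apply/esym; apply: (jinv_homography g1); rewrite ?others_uniq//.
  exact: size_others.
by rewrite -!map_comp; apply: eq_map => i /=; rewrite xy.
Qed.

Lemma J_perm (s : 'S_5) (x : V F) : J (permV s x) = perm5 s (J x).
Proof.
apply/ffunP => l; rewrite !ffunE; congr (P1aff (jinv _)).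
apply/predeqP => p; split=> [[i il <-]|[i il <-]] /=.
  by exists (s i); rewrite ?ffunE//= (inj_eq perm_inj).
exists (s^-1%g i); rewrite /= ?ffunE ?permKV//.
by apply: contra il => /eqP <-; rewrite permKV.
Qed.

Lemma JbarE (x : V F) :
  Jbar (\pi_(PmodS5 F) (\pi_(P F) x)) = \pi_(Sym5 (P1 F)) (J x).
Proof.
rewrite /Jbar; set c := \pi_(PmodS5 F) _.
have /eqmodP/existsP[s /eqP] : repr c = \pi_(P F) x %[mod PmodS5 F].
  by rewrite reprK.
rewrite -[in permP s _](reprK (repr c)) permP_pi => /eqmodP/J_sl2 ->.
by rewrite J_perm; apply/eqmodP/existsP; exists s.
Qed.

End WellDefined.

(* Main.v *)
Require Import Defs.
From mathcomp Require Import all_boot all_order all_algebra.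
From mathcomp Require Import all_fingroup generic_quotient.
From mathcomp Require Import boolp classical_sets.
From mathcomp Require Import reals complex.
From mathcomp Require Import ring.

(* Label the five points so that one nonzero j-invariant, common to both
   quintuples, is that of the first four, and move these to 0, 1, oo, t. After
   that the two quintuples are (0, 1, oo, t, s) and (0, 1, oo, t, s'), and s
   matters only up to the Klein four-group of {0, 1, oo, t}. The quotient of
   the invariant of degree 4 by the square root of the discriminant is, t being
   fixed and t^2 - t + 1 nonzero, a coordinate w on this Klein quotient, and the
   sum of the five j-invariants is an affine function of w^2. Hence w(s') = w(s),
   and the quintuples are equivalent, or w(s') = - w(s). In the second case the
   odd part in w of the sum of the squares of the j-invariants must vanish; it
   factors completely over Q(t), each factor provides an explicit odd
   permutation of the points that keeps t and changes the sign of w, and this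
   reduces to the first case. *)

Set Implicit Arguments.
Unset Strict Implicit.
Unset Printing Implicit Defensive.

Import Order.TTheory GRing.Theory Num.Theory.
Local Open Scope ring_scope.
Local Open Scope quotient_scope.

(** * The j-function, cross-ratios and two invariants of the binary quintic *)

Definition jfun (F : fieldType) (u : F) : F :=
  4 / 27 * ((u ^+ 2 - u + 1) ^+ 3 / (u ^+ 2 * (u - 1) ^+ 2)).

(** The i-th entry is a parameter of the four points left when the i-th of 0, 1, oo, [t], [s] is
    omitted. *)
Definition crossratios (F : fieldType) (t s : F) : seq F :=
  [:: (1 - s) / (1 - t); s / t; (1 - s^-1) / (1 - t^-1); s; t].

Section Algebra.
Variable F : numFieldType.
Implicit Types t s u : F.

Lemma jfun_eq0 u : u != 0 -> u != 1 -> (jfun u == 0) = (u ^+ 2 - u + 1 == 0).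
Proof.
move=> u0 u1; have c0 : 4 / 27 != 0 :> F by rewrite mulf_neq0 ?invr_eq0 ?pnatr_eq0.
rewrite /jfun mulf_eq0 (negPf c0) mulf_eq0 expf_eq0 /= invr_eq0 mulf_eq0 !expf_eq0 /=.
by rewrite subr_eq0 (negPf u0) (negPf u1) !orbF.
Qed.

(* Up to constants, [wnum t s] is the invariant of degree 4 of the quintic
   x y (x - y) (x - t y) (x - s y), and (t (t - 1) wden t s)^2 is its
   discriminant; as quartic forms in s, both are invariant under the Klein
   four-group of {0, 1, oo, t}. *)
Definition wnum t s : F :=
  (t ^+ 2 - t + 1) * (s ^+ 4 + t ^+ 2)
  - (t + 1) * (2 * t ^+ 2 - t + 2) / 2 * (s ^+ 3 + t * s)
  + (2 * t ^+ 4 - t ^+ 3 + 6 * t ^+ 2 - t + 2) / 2 * s ^+ 2.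
Definition wden t s : F := s * (s - 1) * (s - t).
Definition wfun t s : F := wnum t s / wden t s.

Definition generic t s := [&& t != 0, t != 1, s != 0, s != 1 & s != t].

Lemma generic_nz t s : generic t s ->
  [/\ t != 0, t - 1 != 0, s != 0, s - 1 != 0 & s - t != 0].
Proof. by case/and5P; rewrite !subr_eq0; split. Qed.

Lemma subr_neq0C (a b : F) : a - b != 0 -> b - a != 0.
Proof. by rewrite -opprB oppr_eq0. Qed.

(** Times the discriminant, the sum is an invariant of degree 8 of the quintic, hence a combination
    of the square of the invariant of degree 4 and of the discriminant itself. *)
Lemma sum_jfun t s : generic t s ->
  \sum_(u <- crossratios t s) jfun u =
  4 / 27 * ((wfun t s / (t * (t - 1))) ^+ 2 + 35 / 4).
Proof.
case/generic_nz => t0 t1 s0 s1 st.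
rewrite /crossratios !big_cons big_nil /jfun /wfun /wnum /wden.
field.
rewrite t0 t1 s0 s1 st (subr_neq0C t1) (subr_neq0C s1) /= andbT.
by rewrite mulN1r opprB addrC addrA subrK subr_neq0C.
Qed.

Definition evenpart t w : F :=
  let d := t ^+ 2 - t in
  (d ^+ 3 - d ^+ 2 + 3 * d + 1) * w ^+ 4
  + (- 4 - 24 * d - 77 / 2 * d ^+ 2 - 31 / 2 * d ^+ 3 + 27 / 2 * d ^+ 4
     - 5 / 2 * d ^+ 5 - 4 * d ^+ 6) * w ^+ 2
  + 745 / 16 * (d + 1) ^+ 3 * d ^+ 4.

Definition oddcof t w : F :=
  let d := t ^+ 2 - t in
  (t + 1) * (t - 2) * (2 * t - 1) *
  (2 * d ^+ 2 * w ^+ 2 - (2 + 12 * d + 28 * d ^+ 2 + 34 * d ^+ 3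
     + 49 / 2 * d ^+ 4 + 10 * d ^+ 5 + 2 * d ^+ 6)).

(* No other quintic invariant appears: once t is fixed, the sum is a polynomial
   in w = [wfun t s] after clearing powers of t^2 - t + 1, where w stops being a
   coordinate. [evenpart] and w * [oddcof] are its even and odd parts in w. *)
Lemma sum_jfun_sqr t s : generic t s ->
  (t ^+ 2 - t + 1) ^+ 3 * \sum_(u <- crossratios t s) jfun u ^+ 2 =
  (4 / 27) ^+ 2 / (t * (t - 1)) ^+ 4 *
  (evenpart t (wfun t s) + wfun t s * oddcof t (wfun t s)).
Proof.
case/generic_nz => t0 t1 s0 s1 st.
rewrite /crossratios !big_cons big_nil /jfun /oddcof /evenpart /wfun /wnum /wden.
field.
rewrite t0 t1 s0 s1 st (subr_neq0C t1) (subr_neq0C s1) /= andbT.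
by rewrite mulN1r opprB addrC addrA subrK subr_neq0C.
Qed.

(* Each factor vanishes when some odd permutation maps (0, 1, oo, t, s) to a
   quintuple (0, 1, oo, t, s'') with the same t; the three factors in t alone
   are those with t harmonic. *)
Lemma oddcof_factor t s : generic t s ->
  oddcof t (wfun t s) = - 2 * ((t + 1) * (t - 2) * (2 * t - 1)) *
  ((t * (1 - s) - 1) * (t * s - s + 1)
   * ((t * (s - t) - s) * (t ^+ 2 - t + s))
   * ((t ^+ 2 - t - s + 1) * (t * s - t ^+ 2 + t - 1))
   * ((t * s - t ^+ 2 * s - s + t) * (s * (t ^+ 2 - t + 1) - t ^+ 2)))
  / wden t s ^+ 2.
Proof.
case/generic_nz => t0 t1 s0 s1 st; rewrite /oddcof /wfun /wnum /wden.
by field; rewrite s0 s1 st.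
Qed.

(** The numerator of the difference is [t ^+ 2 - t + 1] times four factors, one for each element of
    the Klein group acting on [s]. *)
Lemma wfun_eq t s s' : generic t s -> generic t s' -> t ^+ 2 - t + 1 != 0 ->
  wfun t s = wfun t s' ->
  [|| s' == s, s' == t / s, s' == (s - t) / (s - 1)
    | s' == t * (s - 1) / (s - t)].
Proof.
case/generic_nz => t0 t1 s0 s1 st /generic_nz[_ _ s'0 s'1 s't] N0 ww.
have : (t ^+ 2 - t + 1) * ((s - s') * (s * s' - t) * (s * s' - s' - s + t)
         * (s * s' - t * s' - t * s + t)) = 0.
  transitivity ((wfun t s - wfun t s') * wden t s * wden t s'); last first.
    by rewrite ww subrr !mul0r.
  by rewrite /wfun /wnum /wden; field; rewrite s0 s1 st s'0 s'1 s't.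
move/eqP; rewrite !mulf_eq0 (negPf N0) /= -!orbA.
case/or4P => /eqP e; apply/or4P; [apply: Or41|apply: Or42|apply: Or43|apply: Or44].
- by rewrite eq_sym -subr_eq0 e.
- have -> : s' = t / s + (s * s' - t) / s by field.
  by rewrite e mul0r addr0.
- have -> : s' = (s - t) / (s - 1) + (s * s' - s' - s + t) / (s - 1) by field.
  by rewrite e mul0r addr0.
- have -> : s' = t * (s - 1) / (s - t) + (s * s' - t * s' - t * s + t) / (s - t).
    by field.
  by rewrite e mul0r addr0.
Qed.

(** The numerator of the difference splits into six factors linear in [t'], one for each element of
    the anharmonic group. The six values are written as words in [u^-1] and [1 - u], the moves used
    in [jfun_move]. *)
Lemma jfun_eq t t' : t != 0 -> t != 1 -> t' != 0 -> t' != 1 ->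
  jfun t = jfun t' ->
  [\/ t' = t, t' = t^-1, t' = 1 - t |
   [\/ t' = (1 - t)^-1, t' = 1 - t^-1 | t' = (1 - (1 - t)^-1)]].
Proof.
rewrite -![_ == 1]subr_eq0 => t0 t1 t'0 t'1 jj.
have : (t' - t) * ((t * t' - 1) * ((t' - (1 - t)) * ((1 - (1 - t) * t') *
         ((t * t' - t + 1) * ((1 - t) * t' + t))))) = 0.
  transitivity ((jfun t - jfun t') * (27 / 4) * (t * t' * (t - 1) * (t' - 1)) ^+ 2).
    by rewrite /jfun; field; rewrite t0 t1 t'0 t'1.
  by rewrite jj subrr !mul0r.
have t1' : 1 - t != 0 by rewrite subr_neq0C.
move/eqP; rewrite 5!mulf_eq0.
case/predU1P => [/subr0_eq->|]; first exact: Or41.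
case/predU1P => [/subr0_eq e|].
  by apply: Or42; apply: (mulfI t0); rewrite e divff.
case/predU1P => [/subr0_eq->|]; first exact: Or43.
case/predU1P => [/subr0_eq e|].
  by apply/Or44/Or31; apply: (mulfI t1'); rewrite -e divff.
case/orP => /eqP e; apply: Or44; [apply: Or32|apply: Or33].
  apply/eqP; rewrite -(inj_eq (mulfI t0)) -subr_eq0 -[X in _ == X]e; apply/eqP.
  by field.
apply/eqP; rewrite -(inj_eq (mulfI t1')) -subr_eq0 -[X in _ == X]e; apply/eqP.
by field.
Qed.

(** The homography u -> 1 / (1 - u) permutes 0, 1, oo cyclically and sends 1 - 1/t to t and t to 1 /
    (1 - t). Exchanging the last two points then restores [t]; the total relabelling is odd, so the
    square root of the discriminant changes sign. *)
Lemma wfun_rot t : generic t (1 - t^-1) ->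
  wfun t (1 - t)^-1 = - wfun t (1 - t^-1).
Proof.
case/generic_nz=> t0 t1 s0 s1 st; rewrite /wfun /wnum /wden.
have X : t - 1 + - t * t != 0.
  by rewrite (_ : _ + _ = (1 - t^-1 - t) * t) ?mulf_neq0//; field.
field; rewrite X t0 t1 (subr_neq0C t1) /=.
rewrite (_ : t - 1 + -1 * t = - 1) ?oppr_eq0 ?oner_eq0//; last by ring.
by rewrite (_ : 1 + - t * (1 - t) = - (t - 1 + - t * t)) ?oppr_eq0//; ring.
Qed.

(** * Moving the fifth point while the first four stay fixed *)

(* [E t s] stands for: a given quintuple is, up to relabelling and homography,
   (0, 1, oo, t, s). *)
Section Moves.
Variable E : F -> F -> Prop.
Hypothesis Egen : forall t s, E t s -> generic t s.
Hypothesis Eswap : forall t s, E t s -> E s t.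
Hypothesis Einv : forall t s, E t s -> E t^-1 s^-1.
Hypothesis Ecompl : forall t s, E t s -> E (1 - t) (1 - s).
Hypothesis Escale : forall t s, E t s -> E t^-1 (s / t).

(** This Klein element exchanges 0 with oo and 1 with [t]; the next two lemmas exchange 0 with [t],
    then 0 with 1. *)
Lemma Eklein1 t s : E t s -> E t (t / s).
Proof.
move=> Ets; have [t0 _ s0 _ _] := generic_nz (Egen Ets).
have := Eswap (Escale (Eswap (Escale (Einv (Eswap Ets))))).
by rewrite !invfM !invrK mulrCA divff ?mulr1.
Qed.

Lemma Eklein2 t s : E t s -> E t ((s - t) / (s - 1)).
Proof.
move=> Ets; have [_ _ _ s1 _] := generic_nz (Egen Ets).
have := Ecompl (Eklein1 (Ecompl Ets)); rewrite subKr.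
by rewrite (_ : 1 - _ = (s - t) / (s - 1))//; field; rewrite s1 subr_neq0C.
Qed.

Lemma Eklein3 t s : E t s -> E t (t * (s - 1) / (s - t)).
Proof. by move=> /Eklein2/Eklein1; rewrite invf_div mulrA. Qed.

Lemma wfun_move t s s' : E t s -> generic t s' -> t ^+ 2 - t + 1 != 0 ->
  wfun t s = wfun t s' -> E t s'.
Proof.
move=> Ets g' N0 /(wfun_eq (Egen Ets) g' N0)/or4P[] /eqP-> //.
- exact: Eklein1.
- exact: Eklein2.
- exact: Eklein3.
Qed.

Lemma move_odd t s s' : E t s -> generic t s' -> t ^+ 2 - t + 1 != 0 ->
  wfun t s' = - wfun t s -> oddcof t (wfun t s) = 0 -> E t s'.
Proof.
move=> Ets g' N0 ww.
have g := Egen Ets; have [t0 t1 s0 s1 st] := generic_nz g.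
(* It suffices to reach some [u] where w has the opposite sign: it then agrees with [s'] up to the
   Klein group. *)
have flip u : E t u -> wfun t u = - wfun t s -> E t s'.
  by move=> Etu uw; apply: (wfun_move Etu g' N0); rewrite uw ww.
(* The roots of the two factors are the points 1 - 1/t and 1 / (1 - t), which the odd relabelling of
   [wfun_rot] relates. *)
have rot u : E t u -> wfun t u = wfun t s ->
    (t * (1 - u) - 1) * (t * u - u + 1) = 0 -> E t s'.
  move=> Etu uw /eqP; rewrite mulf_eq0 => /orP[] /eqP e.
    have ut : u = 1 - t^-1.
      rewrite (_ : u = 1 - t^-1 - (t * (1 - u) - 1) / t); last by field.
      by rewrite e mul0r subr0.
    have gt : generic t (1 - t^-1) by rewrite -ut; exact: Egen.
    apply: (flip (1 - t)^-1); last by rewrite (wfun_rot gt) -uw ut.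
    have := Einv (Ecompl (Eswap Etu)).
    by rewrite {1}ut subKr invrK.
  have t1' := subr_neq0C t1.
  have ut : u = (1 - t)^-1.
    rewrite (_ : u = (1 - t)^-1 - (t * u - u + 1) / (1 - t)); last by field.
    by rewrite e mul0r subr0.
  have Eu : E t (1 - t^-1).
    have := Ecompl (Einv (Eswap Etu)).
    by rewrite {1}ut invrK subKr.
  apply: (flip _ Eu); apply: oppr_inj.
  by rewrite -(wfun_rot (Egen Eu)) opprK -ut.
have k1 u : E t u -> wfun t (t / u) = wfun t u.
  move=> /Egen/generic_nz[_ _ u0 u1 ut]; rewrite /wfun /wnum /wden; field.
  rewrite ut u1 u0 t0.
  rewrite (_ : t + - t * u = - (t * (u - 1))) ?oppr_eq0 ?mulf_neq0 //; last by ring.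
  by rewrite mulN1r subr_neq0C.
have k2 u : E t u -> wfun t ((u - t) / (u - 1)) = wfun t u.
  move=> /Egen/generic_nz[_ _ u0 u1 ut]; rewrite /wfun /wnum /wden; field.
  rewrite ut u1 u0 /=.
  rewrite (_ : u - t + - t * (u - 1) = - (u * (t - 1))); last by ring.
  rewrite (_ : u - t + - 1 * (u - 1) = - (t - 1)); last by ring.
  by rewrite !oppr_eq0 mulf_neq0.
rewrite (oddcof_factor g) => /eqP.
rewrite mulf_eq0 invr_eq0 expf_eq0 /= (_ : wden t s == 0 = false); last first.
  by rewrite !mulf_eq0 (negPf s0) (negPf s1) (negPf st).
rewrite orbF mulf_eq0 => /orP[|].
  rewrite mulf_eq0 oppr_eq0 pnatr_eq0 /= !mulf_eq0 -orbA => /or3P[] /eqP e.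
  (* Harmonic [t]: for -1, 2, 1/2 the involutions 1/u, u/(u - 1), 1 - u fix [t] and one of 0, 1, oo,
     and exchange the other two, an odd permutation. *)
  - have tN : t = -1 by apply/eqP; rewrite -addr_eq0 e.
    apply: (flip s^-1); first by have := Einv Ets; rewrite {1}tN invrN1 -tN.
    rewrite tN opprK in st *; rewrite /wfun /wnum /wden; field.
    by rewrite st s1 s0 mulN1r subr_neq0C.
  - have tN : t = 2 by apply/subr0_eq.
    apply: (flip (s / (s - 1))).
      have := Einv (Ecompl (Einv Ets)).
      have -> : (1 - t^-1)^-1 = t by rewrite tN; field.
      have -> //: (1 - s^-1)^-1 = s / (s - 1).
      by field; rewrite s0 s1.
    rewrite tN in st *; rewrite /wfun /wnum /wden; field.
    rewrite st s1 s0 /=.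
    rewrite (_ : s + - 2 * (s - 1) = - (s - 2)); last by ring.
    rewrite (_ : s + - 1 * (s - 1) = 1); last by ring.
    by rewrite oppr_eq0 st oner_eq0.
  - have tN : 1 - t = t by rewrite -[RHS]subr0 -e; ring.
    apply: (flip (1 - s)); first by have := Ecompl Ets; rewrite tN.
    have {}tN : t = 1 / 2.
      transitivity ((2 * t - 1) / 2 + 1 / 2); first by field.
      by rewrite e mul0r add0r.
    have st2 : 2 * s - 1 != 0.
      have -> : 2 * s - 1 = 2 * (s - t) by rewrite tN; field.
      by rewrite mulf_neq0// pnatr_eq0.
    rewrite tN /wfun /wnum /wden; field.
    rewrite mulrC st2 s1 s0 (subr_neq0C s1) andbT /=.
    rewrite (_ : (1 - s) * 2 - 1 = - (2 * s - 1)); last by ring.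
    by rewrite (_ : 1 - s - 1 = - s) ?oppr_eq0 ?st2 ?s0//; ring.
(* The other three pairs of factors are the first pair evaluated, up to denominators, at the Klein
   images of [s]. *)
have E1 := Eklein1 Ets; have E2 := Eklein2 Ets; have E3 := Eklein1 E2.
rewrite 3!mulf_eq0 -!orbA => /or4P[] /eqP e.
- exact: (rot s).
- apply: (rot _ E1 (k1 _ Ets)).
  transitivity ((t * (s - t) - s) * (t ^+ 2 - t + s) / s ^+ 2).
    by field.
  by rewrite e mul0r.
- apply: (rot _ E2 (k2 _ Ets)).
  transitivity ((t ^+ 2 - t - s + 1) * (t * s - t ^+ 2 + t - 1) / (s - 1) ^+ 2).
    by field.
  by rewrite e mul0r.
- apply: (rot _ E3); first by rewrite k1// k2.
  transitivity ((t * s - t ^+ 2 * s - s + t) *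
                (s * (t ^+ 2 - t + 1) - t ^+ 2) / (s - t) ^+ 2).
    by field; rewrite st s1.
  by rewrite e mul0r.
Qed.

Lemma sums_move t s s' : E t s -> generic t s' -> t ^+ 2 - t + 1 != 0 ->
  (forall k, \sum_(u <- crossratios t s) jfun u ^+ k =
             \sum_(u <- crossratios t s') jfun u ^+ k) -> E t s'.
Proof.
move=> Ets g' N0 pw; have g := Egen Ets; have [t0 t1 _ _ _] := generic_nz g.
have d0 : t * (t - 1) != 0 by rewrite mulf_neq0.
have c0 : 4 / 27 != 0 :> F by rewrite mulf_neq0 ?invr_eq0 ?pnatr_eq0.
have /eqP : wfun t s ^+ 2 = wfun t s' ^+ 2.
  have := pw 1%N; under eq_bigr do rewrite expr1.
  under [in RHS]eq_bigr do rewrite expr1.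
  rewrite !sum_jfun// => /(mulfI c0)/addIr; rewrite !expr_div_n.
  by apply/mulIf; rewrite invr_eq0 expf_neq0.
rewrite eqf_sqr => /orP[/eqP|/eqP ww]; first exact: wfun_move.
have {}ww : wfun t s' = - wfun t s by rewrite ww opprK.
have := congr1 ( *%R ((t ^+ 2 - t + 1) ^+ 3)) (pw 2).
rewrite !sum_jfun_sqr// ww => /(mulfI _).
have K0 : (4 / 27) ^+ 2 / (t * (t - 1)) ^+ 4 != 0.
  by rewrite mulf_neq0 ?invr_eq0 ?expf_neq0.
move/(_ K0); clear K0.
have -> : evenpart t (- wfun t s) = evenpart t (wfun t s).
  by rewrite /evenpart; ring.
have -> : oddcof t (- wfun t s) = oddcof t (wfun t s).
  by rewrite /oddcof; ring.
(* The even parts cancel, so twice the odd part vanishes: either w is 0 and the sign is harmless, or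
   [oddcof] is 0. *)
move/addrI/eqP; rewrite mulNr -addr_eq0 -mulr2n mulrn_eq0 /= mulf_eq0.
case/orP=> /eqP w0; last exact: (move_odd Ets).
by apply: (wfun_move Ets) => //; rewrite ww w0 oppr0.
Qed.

Lemma jfun_move t s t' : E t s -> t' != 0 -> t' != 1 -> jfun t = jfun t' ->
  exists s', E t' s'.
Proof.
move=> Ets t'0 t'1 jj; have [t0 t1 _ _ _] := and5P (Egen Ets).
case: (jfun_eq t0 t1 t'0 t'1 jj) => [->|->|->|[->|->|->]].
- by exists s.
- by exists s^-1; apply: Einv.
- by exists (1 - s); apply: Ecompl.
- by exists (1 - s)^-1; apply/Einv/Ecompl.
- by exists (1 - s^-1); apply/Ecompl/Einv.
- by exists (1 - (1 - s)^-1); apply/Ecompl/Einv/Ecompl.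
Qed.

End Moves.
End Algebra.

Local Notation o0 := (@Ordinal 5 0 isT).
Local Notation o1 := (@Ordinal 5 1 isT).
Local Notation o2 := (@Ordinal 5 2 isT).
Local Notation o3 := (@Ordinal 5 3 isT).
Local Notation o4 := (@Ordinal 5 4 isT).

(** * Homographies in homogeneous coordinates *)

Section Plane.
Variable F : numFieldType.
Implicit Types (g h : 'M[F]_2) (u v w : 'cV[F]_2).

Lemma homography_line g v : homography g <[v]>%VS = <[g *m v]>%VS.
Proof. by rewrite /homography limg_line lfunE. Qed.

Lemma vline_scale (k : F) v : k != 0 -> <[k *: v]>%VS = <[v]>%VS.
Proof.
move=> k0; apply/eqP; rewrite eqEsubv -!memvE rpredZ ?memv_line//=.
by apply/vlineP; exists k^-1; rewrite scalerA mulVf ?scale1r.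
Qed.

Lemma homographyZ (k : F) g (L : {vspace 'cV[F]_2}) :
  \dim L == 1%N -> k != 0 -> homography (k *: g) L = homography g L.
Proof.
move=> L1 k0; have [v _] := P1_vlineP (Sub L L1 : P1 F); rewrite SubK => ->.
by rewrite !homography_line -scalemxAl vline_scale.
Qed.

Lemma homography_surj g (p : P1 F) : g \in unitmx ->
  exists o, val p = homography g (val (P1opt o)).
Proof.
move=> gu; have [v v0 pv] := P1_vlineP p.
have w0 : invmx g *m v != 0.
  by apply: contraNneq v0 => w0; rewrite -[v](mulKVmx gu) w0 mulmx0.
have dw : \dim <[invmx g *m v]>%VS == 1%N by rewrite dim_vline w0.
have [o oE] := P1optP (Sub <[invmx g *m v]>%VS dw : P1 F).
by exists o; rewrite -oE SubK homography_line mulKVmx.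
Qed.

Definition mx2 (a b c d : F) : 'M[F]_2 :=
  \matrix_(i, j) if i == 0 then (if j == 0 then a else b)
                 else (if j == 0 then c else d).

Lemma mx2_vec2 a b c d x y :
  mx2 a b c d *m vec2 x y = vec2 (a * x + b * y) (c * x + d * y).
Proof. by rewrite [LHS]vec2E !mulmx2E !mxE. Qed.

Lemma scalevE (k : F) v : k *: v = vec2 (k * v 0 0) (k * v 1 0).
Proof. by rewrite [LHS]vec2E !mxE. Qed.

Lemma scale_vec2 (k x y : F) : k *: vec2 x y = vec2 (k * x) (k * y).
Proof. by rewrite scalevE !mxE. Qed.

Lemma unit_mx2 a b c d : (mx2 a b c d \in unitmx) = (a * d - b * c != 0).
Proof. by rewrite unitmxE det2E !mxE unitfE. Qed.

Definition cross v w := v 0 0 * w 1 0 - v 1 0 * w 0 0.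

Lemma cross_neq0 (p q : P1 F) v w : v != 0 -> w != 0 ->
  val p = <[v]>%VS -> val q = <[w]>%VS -> p != q -> cross v w != 0.
Proof.
move=> v0 w0 pv qw; apply: contraNneq => vw.
apply/eqP/val_inj; rewrite pv qw.
move/subr0_eq : vw => vw.
have [k wE] : exists k, w = k *: v.
  have [a0|a0] := eqVneq (v 0 0) 0; last first.
    exists (w 0 0 / v 0 0); rewrite scalevE [LHS]vec2E.
    by rewrite divfK// mulrAC [w 0 0 * _]mulrC -vw mulrAC divff ?mul1r.
  have b0 : v 1 0 != 0.
    by apply: contraNneq v0 => b0; rewrite (vec2E v) a0 b0; apply/eqP/colP => i;
      rewrite !mxE if_same.
  exists (w 1 0 / v 1 0); rewrite scalevE [LHS]vec2E divfK//.
  congr vec2; rewrite a0 mulr0; apply: (mulfI b0).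
  by rewrite -vw a0 mul0r mulr0.
have k0 : k != 0 by apply: contraNneq w0 => k0; rewrite wE k0 scale0r.
by rewrite wE vline_scale.
Qed.

End Plane.

(** * Normal forms of a quintuple: three of its points at 0, 1, oo *)

Section Marking.
Variable F : numFieldType.
Implicit Types (x : V F) (sigma : 'S_5) (t s : F).

Definition frame t s (i : 'I_5) : option F :=
  nth None [:: Some 0; Some 1; None; Some t; Some s] i.

(** Any invertible matrix is allowed, which avoids square roots here; [homography_sl2] returns to
    determinant 1 over a closed field. *)
Definition marked x sigma t s : Prop := exists2 g : 'M[F]_2, g \in unitmx &
  forall i, val (val x (sigma i)) = homography g (val (P1opt (frame t s i))).

Lemma ord5_ind (Q : 'I_5 -> Prop) :
  Q o0 -> Q o1 -> Q o2 -> Q o3 -> Q o4 -> forall i, Q i.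
Proof.
move=> Q0 Q1 Q2 Q3 Q4 [[|[|[|[|[|//]]]]] i5];
  by [have -> : Ordinal i5 = o0 by exact/val_inj |
      have -> : Ordinal i5 = o1 by exact/val_inj |
      have -> : Ordinal i5 = o2 by exact/val_inj |
      have -> : Ordinal i5 = o3 by exact/val_inj |
      have -> : Ordinal i5 = o4 by exact/val_inj].
Qed.

Lemma marked_generic x sigma t s : marked x sigma t s -> generic t s.
Proof.
case=> g gu xE.
have inj i j : frame t s i = frame t s j -> i = j.
  move=> ij; apply: (@perm_inj _ sigma); apply: (injectiveP _ (valP x)).
  by apply: val_inj; rewrite !xE ij.
by apply/and5P; split; apply/eqP => e;
  [have := inj o0 o3|have := inj o1 o3|have := inj o0 o4|have := inj o1 o4
  |have := inj o3 o4]; rewrite /frame /= e => /(_ erefl) /(congr1 val).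
Qed.

Lemma marked_step (tau : 'S_5) h t' s' x sigma t s : h \in unitmx ->
  (forall i, exists2 k, k != 0 &
     h *m vopt (frame t' s' i) = k *: vopt (frame t s (tau i))) ->
  marked x sigma t s -> marked x (tau * sigma)%g t' s'.
Proof.
move=> hu hE [g gu xE]; exists (g *m h) => [|i].
  by rewrite unitmx_mul gu.
have [k k0 kE] := hE i.
rewrite permM xE homographyM !P1opt_line; congr (homography g _).
by rewrite homography_line kE vline_scale.
Qed.

(** The transpositions of this lemma and the next three form a tree on the five labels, so they
    generate the symmetric group; they supply the moves assumed of [E]. *)
Lemma marked_swap x sigma t s :
  marked x sigma t s -> marked x (tperm o3 o4 * sigma)%g s t.
Proof.
apply: (@marked_step _ 1%:M); first exact: unitmx1.
by elim/ord5_ind; exists 1; rewrite ?oner_eq0// mul1mx scale1r permE.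
Qed.

Lemma marked_inv x sigma t s :
  marked x sigma t s -> marked x (tperm o0 o2 * sigma)%g t^-1 s^-1.
Proof.
move=> m; have [t0 t1 s0 s1 st] := and5P (marked_generic m).
apply: (@marked_step _ (mx2 0 1 1 0)) m.
  by rewrite unit_mx2 mul0r mulr1 sub0r oppr_eq0 oner_eq0.
elim/ord5_ind; [exists 1|exists 1|exists 1|exists t^-1|exists s^-1];
  rewrite ?invr_eq0 ?oner_eq0// permE /= mx2_vec2 scale_vec2.
- by congr vec2; ring.
- by congr vec2; ring.
- by congr vec2; ring.
- by congr vec2; field.
- by congr vec2; field.
Qed.

Lemma marked_compl x sigma t s :
  marked x sigma t s -> marked x (tperm o0 o1 * sigma)%g (1 - t) (1 - s).
Proof.
apply: (@marked_step _ (mx2 (- 1) 1 0 1)).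
  by rewrite unit_mx2 mulr0 subr0 mulr1 oppr_eq0 oner_eq0.
elim/ord5_ind; [exists 1|exists 1|exists (-1)|exists 1|exists 1];
  rewrite ?oppr_eq0 ?oner_eq0// permE /= mx2_vec2 scale_vec2; congr vec2; ring.
Qed.

Lemma marked_scale x sigma t s :
  marked x sigma t s -> marked x (tperm o1 o3 * sigma)%g t^-1 (s / t).
Proof.
move=> m; have [t0 t1 s0 s1 st] := and5P (marked_generic m).
apply: (@marked_step _ (mx2 t 0 0 1)) m.
  by rewrite unit_mx2 mulr1 mul0r subr0.
elim/ord5_ind; [exists 1|exists 1|exists t|exists 1|exists 1];
  rewrite ?oner_eq0// permE /= mx2_vec2 scale_vec2.
- by congr vec2; ring.
- by congr vec2; ring.
- by congr vec2; ring.
- by congr vec2; field.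
- by congr vec2; field.
Qed.

Lemma marked_ex x sigma : exists t s, marked x sigma t s.
Proof.
have xinj i j : i != j -> val x (sigma i) != val x (sigma j).
  by rewrite (inj_eq (injectiveP _ (valP x))) (inj_eq perm_inj).
have [v0 v00 p0] := P1_vlineP (val x (sigma o0)).
have [v1 v10 p1] := P1_vlineP (val x (sigma o1)).
have [v2 v20 p2] := P1_vlineP (val x (sigma o2)).
have c20 := cross_neq0 v20 v00 p2 p0 (xinj o2 o0 isT).
have c10 := cross_neq0 v10 v00 p1 p0 (xinj o1 o0 isT).
have c21 := cross_neq0 v20 v10 p2 p1 (xinj o2 o1 isT).
(* By Cramer's rule [a *: v2 + b *: v0] is [cross v2 v0 *: v1], so these columns send oo, 0, 1 to
   the lines of [v2], [v0], [v1]. *)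
pose a := cross v1 v0; pose b := cross v2 v1.
pose g := mx2 (a * v2 0 0) (b * v0 0 0) (a * v2 1 0) (b * v0 1 0).
have gu : g \in unitmx.
  rewrite unit_mx2.
  rewrite (_ : _ - _ = a * b * cross v2 v0) ?mulf_neq0//.
  by rewrite /cross; ring.
have g0 : g *m vopt (Some 0) = b *: v0.
  by rewrite mx2_vec2 scalevE; congr vec2; ring.
have g1 : g *m vopt (Some 1) = cross v2 v0 *: v1.
  rewrite mx2_vec2 scalevE.
  by congr vec2; rewrite /a /b /cross; ring.
have g2 : g *m vopt None = a *: v2.
  by rewrite mx2_vec2 scalevE; congr vec2; ring.
have E2 : val (val x (sigma o2)) = homography g (val (P1opt None)).
  by rewrite p2 P1opt_line homography_line g2 vline_scale.
have aff i : i != o2 -> exists u,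
    val (val x (sigma i)) = homography g (val (P1opt (Some u))).
  move=> i2; have [[u|] uE] := homography_surj (val x (sigma i)) gu.
    by exists u.
  by have := xinj _ _ i2; rewrite -(inj_eq val_inj) uE E2 eqxx.
have [t tE] := aff o3 isT; have [s sE] := aff o4 isT.
exists t, s, g => //; elim/ord5_ind => //.
- by rewrite p0 P1opt_line homography_line g0 vline_scale.
- by rewrite p1 P1opt_line homography_line g1 vline_scale.
Qed.

End Marking.

(** * The j-invariants of a marked quintuple, and injectivity *)

Section Jinvariants.
Variable F : numClosedFieldType.
Implicit Types (x y : V F) (sigma : 'S_5) (t s : F).

Lemma homography_sl2 (g : 'M[F]_2) : g \in unitmx -> exists2 h, \det h = 1 &
  forall p : P1 F, homography h (val p) = homography g (val p).
Proof.
rewrite unitmxE unitfE => g0.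
have r0 : sqrtC (\det g) != 0 by rewrite sqrtC_eq0.
exists ((sqrtC (\det g))^-1 *: g) => [|p].
  by rewrite detZ exprVn sqrtCK mulVf.
by rewrite homographyZ ?invr_eq0 ?(valP p).
Qed.

Definition omitj x l : F := jinv [set val x i | i in [set i | i != l]]%classic.

Lemma omitj_marked x sigma t s :
  marked x sigma t s -> omitj x (sigma o4) = jfun t.
Proof.
move=> m; have [t0 t1 _ _ _] := and5P (marked_generic m).
case: m => g gu xE; have [h h1 hE] := homography_sl2 gu.
rewrite /omitj othersE /jfun -jinv_01infE//.
pose r := [seq P1opt (frame t s ((sigma^-1)%g i)) | i <- enum 'I_5 & i != sigma o4].
have sr : [seq val p | p <- others x (sigma o4)] =
          [seq homography h (val p) | p <- r].
  rewrite -!map_comp; apply: eq_map => i /=.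
  by rewrite hE -xE permKV.
have ur : uniq r.
  apply: (@map_uniq _ _ (homography h \o val)).
  by rewrite -sr (map_inj_uniq val_inj) others_uniq.
have r4 : size r = 4%N.
  by have := size_others x (sigma o4); rewrite -(size_map val) sr size_map.
rewrite (jinv_homography h1 ur r4 (others_uniq _ _) sr); congr jinv.
apply/predeqP => p; split=> /=.
  rewrite /r; case/mapP => i.
  rewrite mem_filter => /andP[i4 _] ->.
  have : (sigma^-1)%g i != o4.
    by apply: contra i4 => /eqP <-; rewrite permKV.
  by move: ((sigma^-1)%g i) => {i i4}; elim/ord5_ind => //= _; tauto.
have mem i : i != o4 -> p = P1opt (frame t s i) -> p \in r.
  move=> i4 ->; apply/mapP; exists (sigma i); rewrite ?permK//.
  by rewrite mem_filter mem_enum (inj_eq perm_inj) i4.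
by case=> [[[] |] |]; [exact: (mem o0)|exact: (mem o1)|exact: (mem o2)|exact: (mem o3)].
Qed.

(** Only the omission of the last point is computed directly; transpositions carry the other indices
    there, changing the parameters. *)
Lemma omitj_crossratios x sigma t s : marked x sigma t s ->
  [seq omitj x (sigma i) | i <- enum 'I_5] = [seq jfun u | u <- crossratios t s].
Proof.
move=> m.
have j3 u v rho : marked x rho u v -> omitj x (rho o3) = jfun v.
  by move/marked_swap/omitj_marked; rewrite permM tpermR.
have j1 u v rho : marked x rho u v -> omitj x (rho o1) = jfun (v / u).
  by move/marked_scale/j3; rewrite permM tpermR.
have j0 u v rho : marked x rho u v -> omitj x (rho o0) = jfun ((1 - v) / (1 - u)).
  by move/marked_compl/j1; rewrite permM tpermR.
have j2 : omitj x (sigma o2) = jfun ((1 - s^-1) / (1 - t^-1)).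
  by move/marked_inv/j0: m; rewrite permM tpermL.
have -> : enum 'I_5 = [:: o0; o1; o2; o3; o4].
  by apply: (inj_map val_inj); rewrite val_enum_ord.
by rewrite /= j2 (j0 _ _ _ m) (j1 _ _ _ m) (j3 _ _ _ m) (omitj_marked m).
Qed.

Lemma sum_omitj x sigma t s k : marked x sigma t s ->
  \sum_i omitj x i ^+ k = \sum_(u <- crossratios t s) jfun u ^+ k.
Proof.
move=> m; rewrite (reindex_inj (@perm_inj _ sigma)) /= -big_enum /=.
by rewrite -(big_map _ xpredT (fun z => z ^+ k)) (omitj_crossratios m) big_map.
Qed.

(** Otherwise [t], [s] and [s / t] would be primitive sixth roots of unity. There are only two,
    inverse to each other, so [s / t] would be t^-2, a cube root of unity. *)
Lemma omitj_neq0 x : exists l, omitj x l != 0.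
Proof.
have [t [s m]] := marked_ex x 1; have [t0 t1 s0 s1 st] := and5P (marked_generic m).
apply/existsP; apply: contraT => /existsPn j0; exfalso.
have : all (fun u => jfun u == 0) (crossratios t s).
  rewrite -(all_map _ (pred1 0)) -(omitj_crossratios m).
  by apply/allP => _ /mapP[i _ ->] /=; rewrite -[_ == _]negbK j0.
case/and5P => _ ht _ hs /andP[hu _].
have jz (u : F) : u != 0 -> u != 1 -> jfun u == 0 -> u ^+ 2 - u + 1 = 0.
  by move=> u0 u1; rewrite (jfun_eq0 u0 u1) => /eqP.
have {hu} nt := jz _ t0 t1 hu; have {hs} ns := jz _ s0 s1 hs.
have nst : (s / t) ^+ 2 - s / t + 1 = 0.
  apply: jz => //; first by rewrite mulf_neq0 ?invr_eq0.
  by apply: contra st => /eqP/(canRL (mulfVK t0)); rewrite mul1r => ->.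
have sE : s = 1 - t.
  apply/eqP; rewrite -subr_eq0.
  have : (s - t) * (s - (1 - t)) = 0.
    transitivity (s ^+ 2 - s + 1 - (t ^+ 2 - t + 1)); first by ring.
    by rewrite nt ns subr0.
  by move/eqP; rewrite mulf_eq0 => /predU1P[/subr0_eq e|//]; rewrite e eqxx in st.
have : 2 = 0 :> F.
  transitivity (3 * (t ^+ 2 - t + 1) - t ^+ 2 * ((s / t) ^+ 2 - s / t + 1)).
    by rewrite sE; field.
  by rewrite nt nst !mulr0 subr0.
by move/eqP; rewrite pnatr_eq0.
Qed.

Lemma marked_pi x y sigma tau t s : marked x sigma t s -> marked y tau t s ->
  \pi_(PmodS5 F) (\pi_(P F) x) = \pi_(PmodS5 F) (\pi_(P F) y).
Proof.
move=> [g gu xE] [h hu yE].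
have [k k1 kE] : exists2 k, \det k = 1 &
    forall p : P1 F, homography k (val p) = homography (h *m invmx g) (val p).
  by apply: homography_sl2; rewrite unitmx_mul hu unitmx_inv.
apply/eqmodP/existsP; exists (tau^-1 * sigma)%g; apply/eqP.
rewrite permP_pi; apply/esym/eqmodP/asboolP; exists k => // i.
have zE : val (val (permV (tau^-1 * sigma) x) i) =
    homography g (val (P1opt (frame t s ((tau^-1)%g i)))).
  by rewrite /= ffunE permM xE.
rewrite -[i in LHS](permKV tau) yE kE zE.
by rewrite homographyM -(homographyM (invmx g)) mulVmx// homography1.
Qed.

Theorem Jbar_inj : injective (@Jbar F).
Proof.
move=> c d; rewrite -[c]reprK -[d]reprK -[repr c]reprK -[repr d]reprK.
move: (repr (repr c)) (repr (repr d)) => {c d} x y.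
rewrite !JbarE => /eqmodP/existsP[rho /eqP Jyx].
have jyx l : omitj y l = omitj x (rho l).
  move/ffunP/(_ l): Jyx; rewrite !ffunE => /(@P1opt_inj F (Some _) (Some _))[].
  by [].
have [l jl] := omitj_neq0 y.
(* The last labels are [rho l] in [x] and [l] in [y], so [t] and [t'] have the same nonzero
   j-invariant. *)
have [t [s mx]] := marked_ex x (tperm o4 l * rho)%g.
have [t' [s' my]] := marked_ex y (tperm o4 l).
have jt := omitj_marked mx; have jt' := omitj_marked my.
rewrite permM tpermL -jyx in jt; rewrite tpermL in jt'.
pose E u v := exists sigma, marked x sigma u v.
have Egen u v : E u v -> generic u v by case=> sigma /marked_generic.
have Eswap u v : E u v -> E v u.
  by case=> sigma /marked_swap; eexists; eassumption.
have Einv u v : E u v -> E u^-1 v^-1.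
  by case=> sigma /marked_inv; eexists; eassumption.
have Ecompl u v : E u v -> E (1 - u) (1 - v).
  by case=> sigma /marked_compl; eexists; eassumption.
have Escale u v : E u v -> E u^-1 (v / u).
  by case=> sigma /marked_scale; eexists; eassumption.
have Ets : E t s by exists (tperm o4 l * rho)%g.
have gy := marked_generic my; have [t'0 t'1 _ _ _] := and5P gy.
have [s'' Es''] : exists s'', E t' s''.
  by apply: (jfun_move Egen Einv Ecompl Ets) => //; rewrite -jt -jt'.
have [//|k|sigma mx'] := sums_move Egen Eswap Einv Ecompl Escale Es'' gy.
- by rewrite -(jfun_eq0 t'0 t'1) -jt'.
- case: Es'' => sigma mx'; rewrite -(sum_omitj k mx') -(sum_omitj k my).
  by rewrite (reindex_inj (@perm_inj _ rho)); apply: eq_bigr => i _; rewrite jyx.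
exact: marked_pi mx' my.
Qed.

End Jinvariants.

Theorem theorem4p1 (R : realType) : injective (@Jbar R[i]).
Proof. exact: Jbar_inj. Qed.
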